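(* If $\Gamma$ is a discrete amenable group, then $\Gamma$ is uniformly $\mathfrak{U}$-stable with a linear estimate.
   Context: $\mathfrak{U}$ is the family of metric groups $(U(n),\|\cdot\|)$, $n\in\mathbf{N}$, where $\|\cdot\|$ is a norm on $M_n(\mathbf{C})$ that is submultiplicative ($\|AB\|\le\|A\|\|B\|$) and unitarily bi-invariant ($\|uAv\|=\|A\|$ for $u,v\in U(n)$), with metric $d(u,v)=\|u-v\|$. For a map $\phi:\Gamma\to G$ with $(G,d_G)\in\mathfrak{U}$, $\phi$ is an $\epsilon$-homomorphism if $\sup_{x,y\in\Gamma}d_G(\phi(xy),\phi(x)\phi(y))\le\epsilon$, and $D(\phi)=\inf_{\psi\in Hom(\Gamma,G)}\sup_{x\in\Gamma}d_G(\phi(x),\psi(x))$. $\Gamma$ is uniformly $\mathfrak{U}$-stable with a linear estimate if there are $\epsilon_0>0$ and $M\ge0$ such that for all $\epsilon<\epsilon_0$ and all $G\in\mathfrak{U}$, every $\epsilon$-homomorphism $\phi:\Gamma\to G$ satisfies $D(\phi)\le M\epsilon$. *)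

(* Defs.v *)
From HB Require Import structures.
From mathcomp Require Import all_boot all_order all_algebra spectral.
From mathcomp Require Import complex.
From mathcomp Require Import boolp classical_sets reals ereal.
From mathcomp Require Import topology metric_structure normedtype.

Set Implicit Arguments.
Unset Strict Implicit.
Unset Printing Implicit Defensive.

Import Order.TTheory GRing.Theory Num.Theory.
Import numFieldNormedType.Exports.
Local Open Scope classical_set_scope.
Local Open Scope complex_scope.
Local Open Scope ring_scope.

#[short(type="metricGroupType")]
HB.structure Definition MetricGroup (K : numDomainType) :=
  { G of Group G & Metric K G }.

Section Stability.
Context {R : realType} {Gamma : groupType}.

(* Suprema and infima of distances are taken in [\bar R], where they always
   exist. *)
Definition eps_homomorphism (G : metricGroupType R) (eps : R)
    (phi : Gamma -> G) : Prop :=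
  (ereal_sup [set (mdist (phi (x * y)%g) (phi x * phi y)%g)%:E
             | x in [set: Gamma] & y in [set: Gamma]] <= eps%:E)%E.

Definition sup_dist (G : metricGroupType R) (phi psi : Gamma -> G) : \bar R :=
  ereal_sup [set (mdist (phi x) (psi x))%:E | x in [set: Gamma]].

Definition hom_defect (G : metricGroupType R) (phi : Gamma -> G) : \bar R :=
  ereal_inf [set sup_dist phi psi
            | psi in [set: UMagmaMorphism.type Gamma G]].

End Stability.

Definition uniformly_stable_linear (R : realType) (Gamma : groupType)
    (I : Type) (F : I -> metricGroupType R) : Prop :=
  exists eps0 M : R, [/\ 0 < eps0, 0 <= M &
    forall eps : R, eps < eps0 ->
    forall (i : I) (phi : Gamma -> F i),
      eps_homomorphism eps phi -> (hom_defect phi <= (M * eps)%:E)%E].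

Section Amenable.
Context {R : realType} {Gamma : groupType}.

(* [m] represents a functional on the space of bounded functions; its values
   at unbounded functions are irrelevant. *)
Record left_invariant_mean (m : (Gamma -> R) -> R) : Prop :=
  LeftInvariantMean {
    mean_linear : forall (a : R) (f g : Gamma -> R),
      bounded_fun f -> bounded_fun g ->
      m (fun x => a * f x + g x) = a * m f + m g;
    mean_ge0 : forall f : Gamma -> R,
      bounded_fun f -> (forall x, 0 <= f x) -> 0 <= m f;
    mean_one : m (fun=> 1) = 1;
    mean_left_invariant : forall (g : Gamma) (f : Gamma -> R),
      bounded_fun f -> m (fun x => f (g^-1 * x)%g) = m f }.

End Amenable.

Definition amenable (R : realType) (Gamma : groupType) : Prop :=
  exists m : (Gamma -> R) -> R, left_invariant_mean m.

(* [Normc.normc] is the modulus of a complex number, as an element of [R].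
   Nonnegativity of the norm follows from the first two axioms. *)
Record ui_norm (R : realType) (n : nat) := UINorm {
  ui_norm_fun :> 'M[R[i]]_n -> R;
  ui_normD : forall A B : 'M[R[i]]_n,
    ui_norm_fun (A + B) <= ui_norm_fun A + ui_norm_fun B;
  ui_normZ : forall (a : R[i]) (A : 'M[R[i]]_n),
    ui_norm_fun (a *: A) = Normc.normc a * ui_norm_fun A;
  ui_norm_eq0 : forall A : 'M[R[i]]_n, ui_norm_fun A = 0 -> A = 0;
  ui_normM : forall A B : 'M[R[i]]_n,
    ui_norm_fun (A *m B) <= ui_norm_fun A * ui_norm_fun B;
  ui_norm_unitary : forall u v A : 'M[R[i]]_n,
    u \is unitarymx -> v \is unitarymx ->
    ui_norm_fun (u *m A *m v) = ui_norm_fun A }.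

(* The norm is a phantom argument, so that the metric can be found from the
   type. *)
Record unitary_group (R : realType) (n : nat) (N : ui_norm R n) :=
  UnitaryGroup {
    unitary_val :> 'M[R[i]]_n;
    unitary_valP : unitary_val \is unitarymx }.

HB.instance Definition _ (R : realType) (n : nat) (N : ui_norm R n) :=
  [isSub for @unitary_val R n N].
HB.instance Definition _ (R : realType) (n : nat) (N : ui_norm R n) :=
  [Choice of unitary_group N by <:].

Section UnitaryGroup.
Context {R : realType} {n : nat} (N : ui_norm R n).
Local Notation U := (unitary_group N).

Fact unitary_one_subproof : (1%:M : 'M[R[i]]_n) \is unitarymx.
Proof. by apply/unitarymxP; rewrite mul1mx trmx1 map_mx1. Qed.

Definition unitary_one : U := UnitaryGroup N unitary_one_subproof.
Definition unitary_mul (u v : U) : U :=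
  UnitaryGroup N (mul_unitarymx (unitary_valP u) (unitary_valP v)).

Fact unitary_inv_subproof (u : U) :
  map_mx Num.conj (unitary_val u)^T \is unitarymx.
Proof. by rewrite trmxC_unitary unitary_valP. Qed.

Definition unitary_inv (u : U) : U := UnitaryGroup N (unitary_inv_subproof u).

Fact unitary_mulA : associative unitary_mul.
Proof. by move=> u v w; apply: val_inj; rewrite /= mulmxA. Qed.
Fact unitary_mul1 : left_id unitary_one unitary_mul.
Proof. by move=> u; apply: val_inj; rewrite /= mul1mx. Qed.
Fact unitary_mulr1 : right_id unitary_one unitary_mul.
Proof. by move=> u; apply: val_inj; rewrite /= mulmx1. Qed.
Fact unitary_mulrV : right_inverse unitary_one unitary_inv unitary_mul.
Proof. by move=> u; apply: val_inj; apply/unitarymxP/unitary_valP. Qed.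
Fact unitary_mulV : left_inverse unitary_one unitary_inv unitary_mul.
Proof.
by move=> u; apply: val_inj; apply: mulmx1C; apply/unitarymxP/unitary_valP.
Qed.

HB.instance Definition _ := isGroup.Build U
  unitary_mulA unitary_mul1 unitary_mulr1 unitary_mulV unitary_mulrV.

Definition unitary_dist (u v : U) : R := N (unitary_val u - unitary_val v).

Fact unitary_distxx u : unitary_dist u u = 0.
Proof.
by rewrite /unitary_dist subrr -(scale0r 0) ui_normZ Normc.normc0 mul0r.
Qed.
Fact unitary_dist_eq0 u v : unitary_dist u v = 0 -> u = v.
Proof. by move/ui_norm_eq0/eqP; rewrite subr_eq0 => /eqP/val_inj. Qed.
Fact unitary_distC u v : unitary_dist u v = unitary_dist v u.
Proof.
rewrite /unitary_dist -opprB -scaleN1r ui_normZ.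
by rewrite /= oppr0 expr0n addr0 sqrrN expr1n sqrtr1 mul1r.
Qed.
Fact unitary_dist_triangle v u w :
  unitary_dist u w <= unitary_dist u v + unitary_dist v w.
Proof. by rewrite /unitary_dist (le_trans _ (ui_normD _ _ _))// subrKA. Qed.

HB.instance Definition _ := isMetric.Build R U
  unitary_distxx unitary_dist_eq0 unitary_distC unitary_dist_triangle.

End UnitaryGroup.

Definition unitary_family (R : realType)
    (i : {n : nat & ui_norm R n}) : metricGroupType R :=
  unitary_group (projT2 i).

(* Main.v *)
Require Import Defs.
From mathcomp Require Import all_boot reals.
From HB Require Import structures.
From mathcomp Require Import all_order all_algebra spectral complex.
From mathcomp Require Import boolp classical_sets ereal.
From mathcomp Require Import topology metric_structure normedtype.
From mathcomp Require Import ring lra.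

(** Let [u] be an [eps]-homomorphism to unitaries, and [M_z] the invariant mean,
    applied entrywise to bounded matrix-valued functions. A mean is a limit of
    convex combinations, so [M_z] does not increase the sup norm
    ([ui_norm_mxmean]). The proof makes [u] multiplicative first, giving up
    unitarity, and restores unitarity at the end.

    Multiplicativity is obtained by a Newton iteration. Replace a map [phi] of
    defect [d] by [psi x = M_z (phi (x z) (phi z)^-1)]. Each integrand is within
    [2 d] of [phi x], hence so is [psi x]; and invariance of the mean cancels
    the first-order part of the defect, so that [psi] has defect at most
    [8 d^2] ([averaging_defect]). From a small [eps] the defects decrease
    geometrically, and the iterates converge to a multiplicative [pi] with
    [pi x] within [4 eps] of [u x] ([averaging_limit]). The iterates are
    invertible because they stay within 1/2 of [u]: submultiplicativity
    alone then bounds division by them ([near_unitary_inv]). In particular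
    neither the size of the matrices nor the norm of the identity, which is not
    bounded over the family, enters the estimates.

    A multiplicative map [pi] close to unitaries is conjugate to a unitary
    representation: the mean [S] of [pi(y^-1)^* pi(y^-1)] satisfies
    [pi(x)^* S pi(x) = S], so that [T pi T^-1] is unitary for [T] the square
    root of [S] ([unitarize]). Here [S] is close to 1, and so is [T], because
    [T - 1] is [S - 1] times a contraction ([hermitian_sqrt]).

    The last step compares adjoints of non-unitary matrices. It is therefore
    convenient to work from the start with the norm [max (N A) (N A^* )], which
    is again bi-invariant and submultiplicative, dominates [N], and agrees with
    [N] on differences of unitaries ([adj_norm_sub_unitary]). *)

Set Implicit Arguments.
Unset Strict Implicit.
Unset Printing Implicit Defensive.

Import Order.TTheory GRing.Theory Num.Theory.
Import numFieldNormedType.Exports.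
Import Normc.
Local Open Scope classical_set_scope.
Local Open Scope complex_scope.
Local Open Scope ring_scope.
Local Open Scope sesquilinear_scope.

Local Notation Re := (@complex.Re _).
Local Notation Im := (@complex.Im _).

(** * The modulus of a complex number *)

Lemma normc_ge0 (R : rcfType) (a : R[i]) : 0 <= normc a.
Proof. by case: a => x y; exact: sqrtr_ge0. Qed.

Lemma normcR (R : rcfType) (x : R) : normc x%:C = `|x|.
Proof. by rewrite /= expr0n addr0 sqrtr_sqr. Qed.

Lemma ge_normRe (R : rcfType) (a : R[i]) : `|Re a| <= normc a.
Proof.
case: a => x y /=; rewrite -sqrtr_sqr; apply: ler_wsqrtr.
by rewrite lerDl sqr_ge0.
Qed.

Lemma ge_normIm (R : rcfType) (a : R[i]) : `|Im a| <= normc a.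
Proof.
case: a => x y /=; rewrite -sqrtr_sqr; apply: ler_wsqrtr.
by rewrite lerDr sqr_ge0.
Qed.

Lemma normc_le (R : rcfType) (a : R[i]) : normc a <= `|Re a| + `|Im a|.
Proof.
case: a => x y /=; rewrite -[leRHS]ger0_norm ?addr_ge0 //.
rewrite -[leRHS]sqrtr_sqr; apply: ler_wsqrtr.
rewrite sqrrD !real_normK ?num_real //.
by rewrite addrAC lerDl mulrn_wge0 // mulr_ge0.
Qed.

Lemma normcJ (R : rcfType) (a : R[i]) : normc (Num.conj a) = normc a.
Proof. by case: a => x y /=; rewrite sqrrN. Qed.

(** * Unitarily bi-invariant submultiplicative norms *)

Lemma delta_mx_neq0 (K : nzRingType) (p q : nat) (i : 'I_p) (j : 'I_q) :
  delta_mx i j != 0 :> 'M[K]_(p, q).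
Proof.
apply/eqP => /matrixP/(_ i j); rewrite !mxE !eqxx => /eqP.
by rewrite oner_eq0.
Qed.

Section UINormTheory.
Context {R : realType} {n : nat} (N : ui_norm R n).
Implicit Types (A B u : 'M[R[i]]_n).

Lemma ui_norm0 : N 0 = 0.
Proof. by rewrite -(scale0r 0) ui_normZ normc0 mul0r. Qed.

Lemma ui_normN A : N (- A) = N A.
Proof. by rewrite -scaleN1r ui_normZ normcN normc1 mul1r. Qed.

Lemma ui_normB A B : N (A - B) <= N A + N B.
Proof. by rewrite (le_trans (ui_normD _ _ _)) // ui_normN. Qed.

Lemma ui_norm_distC A B : N (A - B) = N (B - A).
Proof. by rewrite -opprB ui_normN. Qed.

Lemma ui_norm_ge0 A : 0 <= N A.
Proof.
have := ui_normB A A; rewrite subrr ui_norm0; lra.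
Qed.

Lemma ui_norm_gt0 A : A != 0 -> 0 < N A.
Proof.
move=> A0; rewrite lt_def ui_norm_ge0 andbT.
by apply: contra_neq A0; exact: ui_norm_eq0.
Qed.

Lemma ui_norm_triangle B A C : N (A - C) <= N (A - B) + N (B - C).
Proof. by rewrite (le_trans _ (ui_normD _ _ _)) // subrKA. Qed.

Lemma ui_norm_sum (I : finType) (F : I -> 'M[R[i]]_n) :
  N (\sum_i F i) <= \sum_i N (F i).
Proof.
elim/big_ind2: _ => [|A a B b Aa Bb|//]; first by rewrite ui_norm0.
by rewrite (le_trans (ui_normD _ _ _)) // lerD.
Qed.

Lemma unitarymx1 : 1%:M \is @unitarymx R[i] n n.
Proof. exact: unitary_one_subproof. Qed.

Lemma ui_norm_mulul u A : u \is unitarymx -> N (u *m A) = N A.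
Proof.
by move=> hu; rewrite -[in LHS](mulmx1 (u *m A)) ui_norm_unitary ?unitarymx1.
Qed.

Lemma ui_norm_mulur u A : u \is unitarymx -> N (A *m u) = N A.
Proof.
by move=> hu; rewrite -[in LHS](mul1mx A) ui_norm_unitary ?unitarymx1.
Qed.

(** Together with [entry_le_ui_norm], this makes the norm equivalent to the
    entrywise one. The constants depend on [N]; they only serve for
    convergence and for perturbations that are let tend to zero, so that they
    do not occur in the final estimate. *)
Lemma ui_norm_le_entries : exists C, 0 <= C /\
  forall A d, (forall i j, normc (A i j) <= d) -> N A <= C * d.
Proof.
exists (\sum_i \sum_j N (delta_mx i j)); split.
  by apply: sumr_ge0 => i _; apply: sumr_ge0 => j _; exact: ui_norm_ge0.
move=> A d Ad; rewrite [A in N A]matrix_sum_delta.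
apply: (le_trans (ui_norm_sum _)); rewrite mulr_suml; apply: ler_sum => i _.
apply: (le_trans (ui_norm_sum _)); rewrite mulr_suml; apply: ler_sum => j _.
by rewrite ui_normZ mulrC ler_wpM2l // ui_norm_ge0.
Qed.

(** [A i j *: delta_mx i j] is the product [delta_mx i i *m A *m delta_mx j j],
    whose norm submultiplicativity bounds. *)
Lemma entry_le_ui_norm i j :
  exists C, 0 <= C /\ forall A, normc (A i j) <= C * N A.
Proof.
have Nij := ui_norm_gt0 (delta_mx_neq0 _ i j).
exists (N (delta_mx i i) * N (delta_mx j j) / N (delta_mx i j)); split.
  by rewrite divr_ge0 ?mulr_ge0 ?ui_norm_ge0.
move=> A; rewrite mulrAC ler_pdivlMr // -ui_normZ.
have -> : A i j *: delta_mx i j = delta_mx i i *m A *m delta_mx j j.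
  apply/matrixP => k l; rewrite !mxE (bigD1 j) //= big1 ?addr0; last first.
    by move=> h hj; rewrite !mxE (negPf hj) mulr0.
  rewrite !mxE eqxx (bigD1 i) //= big1 ?addr0; last first.
    by move=> h hi; rewrite !mxE (negPf hi) andbF mul0r.
  by rewrite !mxE !eqxx !andbT mulrC -mulnb natrM mulrAC.
rewrite mulrAC (le_trans (ui_normM _ _ _)) // ler_wpM2r ?ui_norm_ge0 //.
exact: ui_normM.
Qed.

(** If [K *m A = 0] then [K *m u = - (K *m (A - u))], so that
    [N K <= N K / 2]. *)
Lemma near_unitary_unit u A :
  u \is unitarymx -> N (A - u) <= 2^-1 -> A \in unitmx.
Proof.
move=> hu hA; rewrite -row_free_unit -kermx_eq0.
set K := kermx A; have KA : K *m A = 0 by exact: mulmx_ker.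
apply/eqP/(@ui_norm_eq0 _ _ N)/le_anti; rewrite ui_norm_ge0 andbT.
have: N K <= N K * 2^-1.
  rewrite -[leLHS](ui_norm_mulur K hu).
  have -> : K *m u = - (K *m (A - u)) by rewrite mulmxBr KA sub0r opprK.
  rewrite ui_normN (le_trans (ui_normM _ _ _)) //.
  by rewrite ler_wpM2l ?ui_norm_ge0.
lra.
Qed.

(** If [C = B *m invmx A] then [C *m u = B - C *m (A - u)], so that
    [N C <= N B + N C / 2]. *)
Lemma near_unitary_inv u A B :
  u \is unitarymx -> N (A - u) <= 2^-1 -> N (B *m invmx A) <= 2 * N B.
Proof.
move=> hu hA; have Aunit := near_unitary_unit hu hA.
set C := B *m invmx A.
have: N C <= N B + N C * 2^-1.
  rewrite -[in leLHS](ui_norm_mulur C hu).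
  have -> : C *m u = B - C *m (A - u).
    by rewrite mulmxBr mulmxKV // opprB addrC subrK.
  rewrite (le_trans (ui_normB _ _)) // lerD2l (le_trans (ui_normM _ _ _)) //.
  by rewrite ler_wpM2l ?ui_norm_ge0.
lra.
Qed.

End UINormTheory.

(** * Adjoints *)

Section Adjoint.
Context {R : realType} {n : nat}.
Implicit Types (A B u v : 'M[R[i]]_n).

Lemma adjM A B : (A *m B)^t* = B^t* *m A^t*.
Proof. by rewrite trmx_mul map_mxM. Qed.

Lemma adjD A B : (A + B)^t* = A^t* + B^t*.
Proof. by rewrite !raddfD. Qed.

Lemma adjB A B : (A - B)^t* = A^t* - B^t*.
Proof. by rewrite !raddfB. Qed.

Lemma unitary_mulV u : u \is unitarymx -> u^t* *m u = 1%:M.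
Proof. by move=> /unitarymxP/mulmx1C. Qed.

Context (N : ui_norm R n).

(** [u^* - v^* = u^* (v - u) v^*] for unitaries, so that unitarily bi-invariant
    norms do not see the adjoint on differences of unitaries. *)
Lemma ui_norm_adj_unitary u v : u \is unitarymx -> v \is unitarymx ->
  N ((u - v)^t*) = N (u - v).
Proof.
move=> hu hv; have -> : (u - v)^t* = u^t* *m (v - u) *m v^t*.
  rewrite mulmxBr mulmxBl unitary_mulV // mul1mx -mulmxA.
  by move/unitarymxP: hv => ->; rewrite mulmx1 adjB.
by rewrite ui_norm_unitary ?trmxC_unitary // ui_norm_distC.
Qed.

Let M A := Num.max (N A) (N (A^t*)).

Let M_eq A B : N A = N B -> N (A^t*) = N (B^t*) -> M A = M B.
Proof. by rewrite /M => -> ->. Qed.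

Fact adj_normD A B : M (A + B) <= M A + M B.
Proof.
rewrite /M adjD ge_max; apply/andP; split;
  by rewrite (le_trans (ui_normD _ _ _)) // lerD // le_max lexx ?orbT.
Qed.

Fact adj_normZ a A : M (a *: A) = normc a * M A.
Proof.
rewrite /M linearZ map_mxZ !ui_normZ normcJ.
by rewrite maxr_pMr // normc_ge0.
Qed.

Fact adj_norm_eq0 A : M A = 0 -> A = 0.
Proof.
move=> MA; apply: (@ui_norm_eq0 _ _ N); apply/le_anti.
by rewrite ui_norm_ge0 andbT -MA le_max lexx.
Qed.

Fact adj_normM A B : M (A *m B) <= M A * M B.
Proof.
rewrite /M adjM ge_max; apply/andP; split.
  rewrite (le_trans (ui_normM _ _ _)) //.
  by rewrite ler_pM ?ui_norm_ge0 // le_max lexx.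
rewrite (le_trans (ui_normM _ _ _)) // mulrC.
by rewrite ler_pM ?ui_norm_ge0 // le_max lexx orbT.
Qed.

Fact adj_norm_unitary u v A : u \is unitarymx -> v \is unitarymx ->
  M (u *m A *m v) = M A.
Proof.
move=> hu hv; apply: M_eq; first exact: ui_norm_unitary.
by rewrite !adjM mulmxA ui_norm_unitary ?trmxC_unitary.
Qed.

(** The maximum, rather than the sum, keeps the value of [N] on differences of
    unitaries. *)
Definition adj_norm : ui_norm R n :=
  UINorm adj_normD adj_normZ adj_norm_eq0 adj_normM adj_norm_unitary.

Lemma adj_norm_adj A : adj_norm (A^t*) = adj_norm A.
Proof. by rewrite /adj_norm /= /M trmxCK maxC. Qed.

Lemma adj_norm_ge A : N A <= adj_norm A.
Proof. by rewrite /= /M le_max lexx. Qed.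

Lemma adj_norm_sub_unitary u v : u \is unitarymx -> v \is unitarymx ->
  adj_norm (u - v) = N (u - v).
Proof. by move=> hu hv; rewrite /= /M ui_norm_adj_unitary // maxxx. Qed.

End Adjoint.

(** * Means of matrix-valued functions *)

Section Mean.
Context {R : realType} {Gamma : groupType}.
Context (m : (Gamma -> R) -> R) (hm : left_invariant_mean m).
Implicit Types (f g : Gamma -> R) (h k : Gamma -> R[i]).

Lemma bounded_funP f : bounded_fun f <-> exists C, forall x, `|f x| <= C.
Proof.
have PF : ProperFilter (globally [set: Gamma]).
  by apply: globally_properfilter; exact: (I : [set: Gamma] 1%g).
split=> [/(ex_bound f)[C hC]|[C hC]]; first by exists C => x; exact: hC.
by apply/(ex_bound f); exists C => x _; exact: hC.
Qed.

Lemma bounded_fun_cst (a : R) : bounded_fun ((fun=> a) : Gamma -> R).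
Proof. by apply/bounded_funP; exists `|a|. Qed.

Lemma mean0 : m (fun=> 0) = 0.
Proof.
have b0 := bounded_fun_cst 0.
have := mean_linear hm 1 b0 b0.
rewrite (_ : (fun x : Gamma => _) = fun=> 0); last first.
  by apply/funext => x; rewrite mulr0 addr0.
lra.
Qed.

Definition cbounded h := exists C, forall x, normc (h x) <= C.

Lemma cbounded_Re h : cbounded h -> bounded_fun (Re \o h).
Proof.
case=> C hC; apply/bounded_funP; exists C => x.
exact: le_trans (ge_normRe _) (hC x).
Qed.

Lemma cbounded_Im h : cbounded h -> bounded_fun (Im \o h).
Proof.
case=> C hC; apply/bounded_funP; exists C => x.
exact: le_trans (ge_normIm _) (hC x).
Qed.

Lemma cboundedD h k : cbounded h -> cbounded k ->
  cbounded (fun x => h x + k x).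
Proof.
move=> [C hC] [D hD]; exists (C + D) => x.
by rewrite (le_trans (le_normcD _ _)) // lerD.
Qed.

Lemma cboundedZ a h : cbounded h -> cbounded (fun x => a * h x).
Proof.
move=> [C hC]; exists (normc a * C) => x.
by rewrite normcM ler_wpM2l // normc_ge0.
Qed.

Lemma cbounded0 : cbounded (fun=> 0).
Proof. by exists 0 => x; rewrite normc0. Qed.

Definition cmean h : R[i] := m (Re \o h) +i* m (Im \o h).

Lemma meanD f g : bounded_fun f -> bounded_fun g ->
  m (fun x => f x + g x) = m f + m g.
Proof.
move=> bf bg; rewrite -[m f]mul1r -mean_linear //.
by congr m; apply/funext => x; rewrite mul1r.
Qed.

Lemma meanZ a f : bounded_fun f -> m (fun x => a * f x) = a * m f.
Proof.
move=> bf; have b0 := bounded_fun_cst 0.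
rewrite -[RHS]addr0 -mean0 -mean_linear //.
by congr m; apply/funext => x; rewrite addr0.
Qed.

Lemma bounded_funZ a f : bounded_fun f -> bounded_fun (fun x => a * f x).
Proof.
move=> /bounded_funP [C hC]; apply/bounded_funP; exists (`|a| * C) => x.
by rewrite normrM ler_wpM2l.
Qed.

Lemma cmeanD h k : cbounded h -> cbounded k ->
  cmean (fun x => h x + k x) = cmean h + cmean k.
Proof.
move=> bh bk; apply/eqP; rewrite eq_complex /=; apply/andP; split; apply/eqP.
  rewrite -meanD; [|exact: cbounded_Re..].
  by congr m; apply/funext => x /=; case: (h x) (k x) => [? ?] [? ?].
rewrite -meanD; [|exact: cbounded_Im..].
by congr m; apply/funext => x /=; case: (h x) (k x) => [? ?] [? ?].
Qed.

Lemma cmeanZ a h : cbounded h -> cmean (fun x => a * h x) = a * cmean h.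
Proof.
case: a => a b bh; have bR := cbounded_Re bh; have bI := cbounded_Im bh.
apply/eqP; rewrite eq_complex /=; apply/andP; split; apply/eqP.
  rewrite -mulNr -!meanZ // -meanD; [|exact: bounded_funZ..].
  by congr m; apply/funext => x /=; case: (h x) => ? ? /=; rewrite mulNr.
rewrite -!meanZ // -meanD; [|exact: bounded_funZ..].
by congr m; apply/funext => x /=; case: (h x) => ? ? /=; rewrite addrC.
Qed.

Lemma cmean0 : cmean (fun=> 0) = 0.
Proof.
rewrite /cmean (_ : Re \o _ = fun=> 0) // (_ : Im \o _ = fun=> 0) //.
by rewrite mean0.
Qed.

Lemma cmean_cst a : cmean (fun=> a) = a.
Proof.
have b1 : cbounded (fun=> 1) by exists 1 => x; rewrite normc1.
rewrite (_ : (fun=> a) = fun x => a * (fun=> 1) x); last first.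
  by apply/funext => x; rewrite mulr1.
rewrite cmeanZ // /cmean (_ : Re \o _ = fun=> 1) // (_ : Im \o _ = fun=> 0) //.
by rewrite mean0 (mean_one hm) mulr1.
Qed.

Lemma cmean_sum (I : finType) (H : I -> Gamma -> R[i]) :
  (forall i, cbounded (H i)) ->
  cmean (fun x => \sum_i H i x) = \sum_i cmean (H i).
Proof.
move=> bH; suff: forall r : seq I,
    cbounded (fun x => \sum_(i <- r) H i x) /\
    cmean (fun x => \sum_(i <- r) H i x) = \sum_(i <- r) cmean (H i).
  by move=> /(_ (index_enum I)) [].
elim=> [|i r [IHb IHe]].
  have -> : (fun x => \sum_(i <- [::]) H i x) = fun=> 0.
    by apply/funext => x; rewrite big_nil.
  by rewrite big_nil cmean0; split=> //; exact: cbounded0.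
have -> : (fun x => \sum_(j <- i :: r) H j x) =
          (fun x => H i x + \sum_(j <- r) H j x).
  by apply/funext => x; rewrite big_cons.
by rewrite big_cons cmeanD // IHe; split=> //; exact: cboundedD.
Qed.

Lemma cmean_conj h : cbounded h ->
  cmean (fun x => Num.conj (h x)) = Num.conj (cmean h).
Proof.
move=> bh; apply/eqP; rewrite eq_complex /=; apply/andP; split; apply/eqP.
  by congr m; apply/funext => x /=; case: (h x).
rewrite -mulN1r -meanZ; last exact: cbounded_Im.
by congr m; apply/funext => x /=; case: (h x) => ? ? /=; rewrite mulN1r.
Qed.

Lemma cmean_left_invariant (g : Gamma) h : cbounded h ->
  cmean (fun x => h (g^-1 * x)%g) = cmean h.
Proof.
move=> bh; rewrite /cmean.
have bR := cbounded_Re bh; have bI := cbounded_Im bh.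
by congr Complex; [exact: mean_left_invariant bR|exact: mean_left_invariant bI].
Qed.

Context {n : nat} (N : ui_norm R n).
Implicit Types (F G : Gamma -> 'M[R[i]]_n) (A : 'M[R[i]]_n).

Definition mxbounded F := exists C, forall x, N (F x) <= C.

Lemma mxbounded_entry F i j : mxbounded F -> cbounded (fun x => F x i j).
Proof.
case=> C FC; have [D [D0 hD]] := entry_le_ui_norm N i j.
by exists (D * C) => x; rewrite (le_trans (hD _)) // ler_wpM2l.
Qed.

Lemma mxbounded_cst A : mxbounded (fun=> A).
Proof. by exists (N A). Qed.

Lemma mxboundedD F G : mxbounded F -> mxbounded G ->
  mxbounded (fun x => F x + G x).
Proof.
move=> [C hC] [D hD]; exists (C + D) => x.
by rewrite (le_trans (ui_normD _ _ _)) // lerD.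
Qed.

Lemma mxboundedM F G : mxbounded F -> mxbounded G ->
  mxbounded (fun x => F x *m G x).
Proof.
move=> [C hC] [D hD]; exists (C * D) => x.
by rewrite (le_trans (ui_normM _ _ _)) // ler_pM // ui_norm_ge0.
Qed.

Lemma mxboundedN F : mxbounded F -> mxbounded (fun x => - F x).
Proof. by move=> [C hC]; exists C => x; rewrite ui_normN. Qed.

Lemma mxboundedB F G : mxbounded F -> mxbounded G ->
  mxbounded (fun x => F x - G x).
Proof. by move=> bF bG; apply: mxboundedD => //; exact: mxboundedN. Qed.

Definition mxmean F : 'M[R[i]]_n := \matrix_(i, j) cmean (fun x => F x i j).

Lemma mxmean_cst A : mxmean (fun=> A) = A.
Proof. by apply/matrixP => i j; rewrite mxE cmean_cst. Qed.

Lemma mxmeanD F G : mxbounded F -> mxbounded G ->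
  mxmean (fun x => F x + G x) = mxmean F + mxmean G.
Proof.
move=> bF bG; apply/matrixP => i j; rewrite !mxE -cmeanD.
- by congr cmean; apply/funext => x; rewrite mxE.
- exact: mxbounded_entry.
- exact: mxbounded_entry.
Qed.

Lemma mxmean_mull A F : mxbounded F ->
  mxmean (fun x => A *m F x) = A *m mxmean F.
Proof.
move=> bF; apply/matrixP => i j; rewrite !mxE.
under eq_fun do rewrite mxE.
rewrite cmean_sum => [|k]; last exact/cboundedZ/mxbounded_entry.
by apply: eq_bigr => k _; rewrite mxE cmeanZ //; exact: mxbounded_entry.
Qed.

Lemma mxmean_mulr A F : mxbounded F ->
  mxmean (fun x => F x *m A) = mxmean F *m A.
Proof.
move=> bF; apply/matrixP => i j; rewrite !mxE.
have -> : (fun x => (F x *m A) i j) = (fun x => \sum_k A k j * F x i k).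
  by apply/funext => x; rewrite mxE; apply: eq_bigr => k _; rewrite mulrC.
rewrite cmean_sum => [|k]; last exact/cboundedZ/mxbounded_entry.
by apply: eq_bigr => k _; rewrite mxE cmeanZ 1?mulrC //; exact: mxbounded_entry.
Qed.

Lemma mxmeanN F : mxbounded F -> mxmean (fun x => - F x) = - mxmean F.
Proof.
move=> bF; rewrite -[in RHS](mul1mx (mxmean F)) -mulNmx -mxmean_mull //.
by congr mxmean; apply/funext => x; rewrite mulNmx mul1mx.
Qed.

Lemma mxmeanB F G : mxbounded F -> mxbounded G ->
  mxmean (fun x => F x - G x) = mxmean F - mxmean G.
Proof. by move=> bF bG; rewrite mxmeanD ?mxmeanN //; exact: mxboundedN. Qed.

Lemma mxmean_adj F : mxbounded F ->
  mxmean (fun x => (F x)^t*) = (mxmean F)^t*.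
Proof.
move=> bF; apply/matrixP => i j; rewrite !mxE -cmean_conj.
  by congr cmean; apply/funext => x; rewrite !mxE.
exact: mxbounded_entry.
Qed.

Lemma mxmean_left_invariant (g : Gamma) F : mxbounded F ->
  mxmean (fun x => F (g^-1 * x)%g) = mxmean F.
Proof.
move=> bF; apply/matrixP => i j; rewrite !mxE.
exact: (cmean_left_invariant _ (mxbounded_entry i j bF)).
Qed.

(** The constant depends on the norm, which the final estimate cannot afford;
    the bound only serves to neglect small perturbations of the integrand. *)
Lemma mxmean_crude_bound : exists C, 0 <= C /\
  forall F d, (forall x, N (F x) <= d) -> N (mxmean F) <= C * d.
Proof.
have mean_le f d : (forall x, `|f x| <= d) -> `|m f| <= d.
  move=> fd; have bf : bounded_fun f by apply/bounded_funP; exists d.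
  have b1 := bounded_fun_cst 1.
  have md : m (fun x => d * 1) = d by rewrite meanZ // (mean_one hm) mulr1.
  have bd : bounded_fun ((fun=> d * 1) : Gamma -> R) by exact: bounded_funZ.
  rewrite ler_norml; apply/andP; split.
    rewrite -subr_ge0 opprK -[X in _ + X]md -meanD //.
    apply: (mean_ge0 hm) => [|x].
      apply/bounded_funP; exists (d + `|d * 1|) => x.
      by rewrite (le_trans (ler_normD _ _)) // lerD.
    by have := fd x; rewrite mulr1 ler_norml; lra.
  have bN : bounded_fun (fun x => -1 * f x) by exact: bounded_funZ.
  rewrite -subr_ge0 -[X in X - _]md -mulN1r -meanZ // -meanD //.
  apply: (mean_ge0 hm) => [|x].
    apply/bounded_funP; exists (`|d * 1| + d) => x.
    by rewrite (le_trans (ler_normD _ _)) // lerD // mulN1r normrN.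
  by have := fd x; rewrite mulr1 ler_norml; lra.
have [C [C0 hC]] := ui_norm_le_entries N.
pose D := \sum_i \sum_j projT1 (cid (entry_le_ui_norm N i j)).
have D0 i j : 0 <= projT1 (cid (entry_le_ui_norm N i j)).
  by case: cid => ? [].
exists (C * (2 * D)); split.
  rewrite !mulr_ge0 // sumr_ge0 // => i _.
  by rewrite sumr_ge0 // => j _; exact: D0.
move=> F d Fd.
have d0 : 0 <= d by apply: le_trans (Fd 1%g); exact: ui_norm_ge0.
rewrite -!mulrA; apply: hC => i j; rewrite mxE.
set c := cmean _.
have cD x : normc (F x i j) <= D * d.
  have : normc (F x i j) <= projT1 (cid (entry_le_ui_norm N i j)) * d.
    case: cid => e [e0 he] /=; rewrite (le_trans (he _)) // ler_wpM2l //.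
  move=> /le_trans; apply; rewrite ler_wpM2r // /D (bigD1 i) //= (bigD1 j) //=.
  rewrite -addrA lerDl; apply: addr_ge0.
    by apply: sumr_ge0 => k _; exact: D0.
  by apply: sumr_ge0 => k _; apply: sumr_ge0 => l _; exact: D0.
rewrite (le_trans (normc_le _)) // mulr_natl mulr2n.
apply: lerD; apply: mean_le => x.
  by rewrite (le_trans _ (cD x)) // ge_normRe.
by rewrite (le_trans _ (cD x)) // ge_normIm.
Qed.

(** For a function with finitely many values, the mean is a convex
    combination of these values. *)
Lemma mxmean_simple_bound (J : finType) (q : Gamma -> J)
    (V : J -> 'M[R[i]]_n) c :
  (forall j, N (V j) <= c) -> N (mxmean (fun x => V (q x))) <= c.
Proof.
move=> Vc; pose w j x : R := (q x == j)%:R.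
have bw j : bounded_fun (w j).
  apply/bounded_funP; exists 1 => x.
  by rewrite /w; case: eqP => _; rewrite ?normr1 ?normr0.
have w0 j : 0 <= m (w j).
  by apply: (mean_ge0 hm) => // x; exact: ler0n.
have cw j : cbounded (fun x => (w j x)%:C).
  by exists 1 => x; rewrite normcR /w; case: eqP => _; rewrite ?normr1 ?normr0.
have cmw j : cmean (fun x => (w j x)%:C) = (m (w j))%:C.
  rewrite /cmean; congr Complex; rewrite -[RHS]mean0.
  by congr m.
have w1 : \sum_j m (w j) = 1.
  apply: (@complexI R); rewrite rmorph_sum /=.
  under eq_bigr do rewrite -cmw.
  rewrite -cmean_sum // -[RHS](cmean_cst 1).
  congr cmean; apply/funext => x; rewrite (bigD1 (q x)) //= big1 ?addr0.
    by rewrite /w eqxx.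
  by move=> j /negPf; rewrite /w eq_sym => ->.
have -> : mxmean (fun x => V (q x)) = \sum_j (m (w j))%:C *: V j.
  apply/matrixP => i k; rewrite mxE summxE.
  under [RHS]eq_bigr do rewrite mxE -cmw mulrC -cmeanZ //.
  rewrite -cmean_sum => [|j]; last exact: cboundedZ.
  congr cmean; apply/funext => x; rewrite (bigD1 (q x)) //= big1 ?addr0.
    by rewrite /w eqxx mulr1.
  by move=> j /negPf; rewrite /w eq_sym => ->; rewrite mulr0.
rewrite (le_trans (ui_norm_sum _ _)) // -[leRHS]mul1r -w1 mulr_suml.
by apply: ler_sum => j _; rewrite ui_normZ normcR ger0_norm // ler_wpM2l.
Qed.

(** Grid of mesh [d]: the integer parts of [(f i x + C) / d] take finitely many
    values, and determine each [f i x] up to [d]. *)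
Lemma bounded_grid (I : finType) (f : I -> Gamma -> R) C d :
  (forall i x, `|f i x| <= C) -> 0 < d ->
  exists (J : finType) (q : Gamma -> J), forall x y, q x = q y ->
    forall i, `|f i x - f i y| <= d.
Proof.
move=> fC d0.
pose t i x := Num.truncn ((f i x + C) / d).
have pos i x : 0 <= (f i x + C) / d.
  apply: divr_ge0; last exact: ltW.
  by have := fC i x; rewrite ler_norml; lra.
have tK i x : (t i x < (Num.truncn ((C + C) / d)).+1)%N.
  rewrite ltnS; apply: le_truncn; rewrite ler_pM2r ?invr_gt0 // lerD2r.
  by have := fC i x; rewrite ler_norml => /andP[].
exists {ffun I -> 'I_(Num.truncn ((C + C) / d)).+1}.
exists (fun x => [ffun i => Ordinal (tK i x)]) => x y qxy i.
have txy : t i x = t i y.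
  by move/ffunP: qxy => /(_ i); rewrite !ffunE => /(congr1 val).
have /andP[x1 x2] := truncn_itv (pos i x).
have /andP[y1 y2] := truncn_itv (pos i y).
rewrite -/(t i x) -/(t i y) txy -natr1 in x1 x2 y1 y2.
rewrite -[leRHS]mul1r -ler_pdivrMr // -[d in _ / d](gtr0_norm d0).
rewrite -normf_div mulrBl.
have -> : f i x / d - f i y / d = (f i x + C) / d - (f i y + C) / d.
  by field; rewrite gt_eqF.
by rewrite ler_norml; lra.
Qed.

(** Approximate [F] uniformly by functions [G] with finitely many values, all
    taken by [F]: the mean of [G] obeys the sharp bound, and the crude one
    makes the error arbitrarily small. *)
Lemma ui_norm_mxmean F c : (forall x, N (F x) <= c) -> N (mxmean F) <= c.
Proof.
move=> Fc.
have bF : mxbounded F by exists c.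
have [C1 [C10 crude]] := mxmean_crude_bound.
have [C2 [C20 entries]] := ui_norm_le_entries N.
apply/ler_addgt0Pr => e e0.
pose I := ('I_n * 'I_n * bool)%type.
pose f (i : I) x : R := let z := F x i.1.1 i.1.2 in if i.2 then Re z else Im z.
have [C fC] : exists C, forall i x, `|f i x| <= C.
  pose D (i : I) := projT1 (cid (mxbounded_entry i.1.1 i.1.2 bF)).
  have fD i x : `|f i x| <= D i.
    rewrite /D; case: cid => /= B hB; rewrite (le_trans _ (hB x)) // /f.
    by case: i.2; rewrite ?ge_normRe ?ge_normIm.
  exists (\sum_i D i) => i x; rewrite (bigD1 i) //= (le_trans (fD i x)) //.
  rewrite lerDl sumr_ge0 // => j _; exact: le_trans (fD j x).
(* The mesh is chosen so that the error, amplified by the two crude constants,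
   is at most [e]. *)
pose d := e / (2 * (C1 * C2 + 1)).
have d0 : 0 < d by rewrite divr_gt0 ?mulr_gt0 ?ltr_wpDl ?mulr_ge0.
have [J [q hq]] := bounded_grid fC d0.
pose r j :=
  if pselect (exists x, q x = j) is left ex then projT1 (cid ex) else 1%g.
have qr x : q (r (q x)) = q x.
  rewrite /r; case: pselect => [ex|[]]; last by exists x.
  by case: cid.
pose G x := F (r (q x)).
have bG : mxbounded G by exists c => x; exact: Fc.
have -> : mxmean F = mxmean G + mxmean (fun x => F x - G x).
  by rewrite mxmeanB // addrC subrK.
rewrite (le_trans (ui_normD _ _ _)) // lerD //.
  exact: (@mxmean_simple_bound J q (fun j => F (r j))).
have eE : e = C1 * C2 * (2 * d) + 2 * d.
  by rewrite /d; field; rewrite gt_eqF // ltr_wpDl // mulr_ge0.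
rewrite [leRHS]eE -mulrA (le_trans (crude _ (C2 * (2 * d)) _)) //; last first.
  by rewrite lerDl; lra.
move=> x; apply: entries => i j.
rewrite (le_trans (normc_le _)) // mulr_natl mulr2n !mxE.
have := hq _ _ (qr x) (i, j, true); have := hq _ _ (qr x) (i, j, false).
rewrite /f /= /G; case: (F x i j) (F _ i j) => a b [a' b'] /= h1 h2.
by rewrite lerD // distrC.
Qed.

End Mean.

(** * Limits *)

(** Nested intervals: [u k - 2 c / 2 ^ k] increases, [u k + 2 c / 2 ^ k]
    decreases, and the supremum of the former lies in all of these
    intervals. *)
Lemma geometric_limit (R : realType) (c : R) (u : nat -> R) :
  (forall k, `|u k.+1 - u k| <= c / 2 ^+ k) ->
  exists l, forall k, `|u k - l| <= 2 * c / 2 ^+ k.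
Proof.
move=> uc; have e0 k : 0 < 2 ^+ k :> R by exact: exprn_gt0.
pose e k : R := 2 * c / 2 ^+ k.
have eS k : e k = e k.+1 + c / 2 ^+ k.
  by rewrite /e exprS; field; rewrite gt_eqF.
have c0 : 0 <= c.
  by have := le_trans (normr_ge0 _) (uc 0%N); rewrite expr0 divr1.
have eg k : 0 <= e k by apply: divr_ge0; [exact: mulr_ge0|exact: ltW].
have lo_mono : {homo (fun k => u k - e k) : j k / (j <= k)%N >-> j <= k}.
  apply: homo_leq => [//|? ? ?|k]; first exact: le_trans.
  by have := uc k; have := eS k; rewrite ler_norml; lra.
have hi_mono : {homo (fun k => u k + e k) : j k / (j <= k)%N >-> k <= j}.
  apply: homo_leq => [//|? ? ?|k]; first by move/[swap]; exact: le_trans.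
  by have := uc k; have := eS k; rewrite ler_norml; lra.
have lohi j k : u j - e j <= u k + e k.
  have h1 := lo_mono _ _ (leq_maxl j k); have h2 := hi_mono _ _ (leq_maxr j k).
  by have := eg (maxn j k); lra.
pose E : set R := [set u k - e k | k in [set: nat]].
have supE : has_sup E.
  split; first by exists (u 0%N - e 0%N); exists 0%N.
  by exists (u 0%N + e 0%N) => _ [k _ <-].
exists (sup E) => k; rewrite -/(e k) ler_norml.
have h1 : u k - e k <= sup E by apply: sup_upper_bound => //; exists k.
have h2 : sup E <= u k + e k.
  by apply: ge_sup => [|_ [j _ <-]]; [case: supE|].
by lra.
Qed.

Lemma exp2_small (R : realType) (C e : R) : 0 < e ->
  exists k, C / 2 ^+ k <= e.
Proof.
move=> e0; exists (Num.truncn (`|C| / e)).+1; set k := _.+1.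
rewrite ler_pdivrMr ?exprn_gt0 // mulrC -ler_pdivrMr //.
apply: (@le_trans _ _ (`|C| / e)).
  by rewrite ler_pM2r ?invr_gt0 // ler_norm.
have /andP[_ /ltW/le_trans] := truncn_itv (divr_ge0 (normr_ge0 C) (ltW e0)).
by apply; rewrite -/k -natrX ler_nat ltnW // ltn_expl.
Qed.

Lemma mx_geometric_limit (R : realType) (n : nat) (N : ui_norm R n) (c : R)
    (U : nat -> 'M[R[i]]_n) :
  (forall k, N (U k.+1 - U k) <= c / 2 ^+ k) ->
  exists L, exists D, forall k, N (U k - L) <= D / 2 ^+ k.
Proof.
move=> Uc.
have entry (p : R[i] -> R) : (forall z, `|p z| <= normc z) ->
    (forall z w, p (z - w) = p z - p w) ->
  exists E, forall i j, exists l, forall k, `|p (U k i j) - l| <= E / 2 ^+ k.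
  move=> ple pB.
  pose D i j := projT1 (cid (entry_le_ui_norm N i j)).
  have hD i j (A : 'M[R[i]]_n) : normc (A i j) <= D i j * N A.
    by rewrite /D; case: cid => d [].
  have D0 i j : 0 <= D i j by rewrite /D; case: cid => d [].
  have e0 k : 0 < 2 ^+ k :> R by exact: exprn_gt0.
  have c0 : 0 <= c.
    by have := le_trans (ui_norm_ge0 _ _) (Uc 0%N); rewrite expr0 divr1.
  exists (\sum_i \sum_j 2 * (D i j * c)) => i j.
  have [k|l hl] := @geometric_limit R (D i j * c) (fun k => p (U k i j)).
    rewrite -pB (le_trans (ple _)) //.
    have -> : U k.+1 i j - U k i j = (U k.+1 - U k) i j by rewrite !mxE.
    by rewrite (le_trans (hD _ _ _)) // -mulrA ler_wpM2l.
  exists l => k; rewrite (le_trans (hl k)) // ler_pM2r ?invr_gt0 //.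
  have pos a b : 0 <= 2 * (D a b * c) by rewrite !mulr_ge0.
  rewrite (bigD1 i) //= (bigD1 j) //= -addrA lerDl; apply: addr_ge0.
    by apply: sumr_ge0 => b _; exact: pos.
  by apply: sumr_ge0 => a _; apply: sumr_ge0 => b _; exact: pos.
have [E1 hRe] :=
  entry Re (@ge_normRe R) (raddfB (@complex.Re R : Rcomplex R -> R)).
have [E2 hIm] :=
  entry Im (@ge_normIm R) (raddfB (@complex.Im R : Rcomplex R -> R)).
have [C [C0 hC]] := ui_norm_le_entries N.
exists (\matrix_(i, j)
  (projT1 (cid (hRe i j)) +i* projT1 (cid (hIm i j)))).
exists (C * (E1 + E2)) => k; rewrite -mulrA; apply: hC => i j; rewrite !mxE.
case: cid => a ha; case: cid => b hb /=.
rewrite (le_trans (normc_le _)) // mulrDl.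
by have := ha k; have := hb k; case: (U k i j) => x y /= h1 h2; exact: lerD.
Qed.

(** * Improving approximate homomorphisms by averaging *)

Section Newton.
Context {R : realType} {Gamma : groupType}.
Context (m : (Gamma -> R) -> R) (hm : left_invariant_mean m).
Context {n : nat} (N : ui_norm R n).
Implicit Types phi u : Gamma -> 'M[R[i]]_n.

Definition defect_le phi d :=
  forall x y, N (phi (x * y)%g - phi x *m phi y) <= d.

Definition near_unitary u phi d :=
  forall x, u x \is unitarymx /\ N (phi x - u x) <= d.

(** When [phi] is a homomorphism, every integrand is [phi x] and averaging does
    not move it. *)
Definition averaging phi x : 'M[R[i]]_n :=
  mxmean m (fun z => phi (x * z)%g *m invmx (phi z)).

Section Step.
Context (u phi : Gamma -> 'M[R[i]]_n) (d : R).
Hypothesis phi_near : near_unitary u phi 2^-1.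
Hypothesis phi_defect : defect_le phi d.

Let q x z := phi (x * z)%g *m invmx (phi z).

Let q_near x z : N (q x z - phi x) <= 2 * d.
Proof.
have [uz hz] := phi_near z; have pz := near_unitary_unit uz hz.
have -> : q x z - phi x = (phi (x * z)%g - phi x *m phi z) *m invmx (phi z).
  by rewrite mulmxBl mulmxK.
by rewrite (le_trans (near_unitary_inv _ uz hz)) // ler_pM2l.
Qed.

Let q_bounded x : mxbounded N (q x).
Proof.
exists (2 * d + N (phi x)) => z; rewrite -[q x z](subrK (phi x)).
by rewrite (le_trans (ui_normD _ _ _)) // lerD2r.
Qed.

Lemma averaging_near x : N (averaging phi x - phi x) <= 2 * d.
Proof.
rewrite -[in X in _ - X](mxmean_cst hm (phi x)) -(mxmeanB hm (N := N)) //.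
- by apply: (ui_norm_mxmean hm) => z; exact: q_near.
- exact: q_bounded.
- exact: mxbounded_cst.
Qed.

(** With [q x z = phi (x z) (phi z)^-1], invariance of the mean gives
    [psi x = M_z (q x z) = M_z (q x (y z))] for the average [psi], and
    [psi x psi y - psi (x y)] is the mean over [z] of
    [(psi x - q x (y z)) (q y z - phi y)]: the term in [phi y] averages to
    zero. The factors are at most [4 d] and [2 d]. *)
Lemma averaging_defect : defect_le (averaging phi) (8 * d ^+ 2).
Proof.
move=> x y; set psi := averaging phi.
have d0 : 0 <= d by apply: le_trans (phi_defect 1%g 1%g); exact: ui_norm_ge0.
have shift : mxmean m (fun z => q x (y * z)%g) = psi x.
  by have := mxmean_left_invariant hm y^-1%g (q_bounded x); rewrite invgK.
have bshift : mxbounded N (fun z => q x (y * z)%g).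
  by have [C hC] := q_bounded x; exists C => z; exact: hC.
have qq z : q x (y * z)%g *m q y z = q (x * y)%g z.
  have [uz hz] := phi_near (y * z)%g; have pz := near_unitary_unit uz hz.
  by rewrite /q mulmxA mulmxKV // mulgA.
rewrite ui_norm_distC.
have -> : psi x *m psi y - psi (x * y)%g =
    mxmean m (fun z => (psi x - q x (y * z)%g) *m (q y z - phi y)).
  have b1 : mxbounded N (fun z => psi x *m q y z).
    exact: (mxboundedM (mxbounded_cst _ _)).
  have b2 : mxbounded N (fun z => q x (y * z)%g *m phi y).
    exact: (mxboundedM _ (mxbounded_cst _ _)).
  have b3 : mxbounded N (fun z : Gamma => psi x *m phi y).
    exact: mxbounded_cst.
  have -> : (fun z => (psi x - q x (y * z)%g) *m (q y z - phi y)) =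
     (fun z => (psi x *m q y z - q (x * y)%g z) -
               (psi x *m phi y - q x (y * z)%g *m phi y)).
    apply/funext => z; rewrite mulmxBl !mulmxBr qq.
    by rewrite !opprB addrACA [RHS]addrACA [- _ + _]addrC.
  rewrite (mxmeanB hm (mxboundedB b1 (q_bounded _)) (mxboundedB b3 b2)).
  rewrite (mxmeanB hm b1 (q_bounded _)) (mxmeanB hm b3 b2).
  rewrite (mxmean_mull hm _ (q_bounded y)) (mxmean_mulr hm _ bshift) shift.
  by rewrite mxmean_cst // subrr subr0.
apply: (ui_norm_mxmean hm) => z.
have h1 : N (psi x - q x (y * z)%g) <= 4 * d.
  rewrite (le_trans (ui_norm_triangle _ (phi x) _ _)) //.
  have -> : 4 * d = 2 * d + 2 * d by ring.
  by rewrite lerD ?averaging_near // ui_norm_distC q_near.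
rewrite (le_trans (ui_normM _ _ _)) //.
have -> : 8 * d ^+ 2 = (4 * d) * (2 * d) by ring.
by rewrite ler_pM ?ui_norm_ge0.
Qed.

End Step.

Context (u : Gamma -> 'M[R[i]]_n) (eps : R).
Hypothesis u_unitary : forall x, u x \is unitarymx.
Hypothesis u_defect : defect_le u eps.
Hypothesis eps_small : eps <= 16^-1.

Let psi k := iter k averaging u.

Let eps_ge0 : 0 <= eps.
Proof. by apply: le_trans (u_defect 1%g 1%g); exact: ui_norm_ge0. Qed.

Let half_pow k : 0 < (1 : R) / 2 ^+ k <= 1.
Proof.
rewrite divr_gt0 ?exprn_gt0 //= ler_pdivrMr ?exprn_gt0 // mul1r.
by rewrite exprn_ege1 // ler1n.
Qed.

Let near_half k phi : near_unitary u phi (4 * eps * (1 - 1 / 2 ^+ k)) ->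
  near_unitary u phi 2^-1.
Proof.
move=> phi_near x; split=> //; apply: le_trans (phi_near x).2 _.
have /andP[k0 k1] := half_pow k.
have := eps_ge0; move: (1 / _) k0 k1 => t; have := eps_small; nra.
Qed.

(** As [16 * eps <= 1], a defect [d <= eps] becomes at most [8 d^2 <= d / 2];
    the moves, twice the defects, then sum up to at most [4 * eps]. *)
Let psi_invariant k :
  near_unitary u (psi k) (4 * eps * (1 - 1 / 2 ^+ k)) /\
  defect_le (psi k) (eps / 2 ^+ k).
Proof.
elim: k => [|k [IHn IHd]].
  split=> [x|x y]; last by rewrite expr0 divr1.
  by split=> //; rewrite subrr ui_norm0 expr0 divr1 subrr mulr0.
have /andP[k0 k1] := half_pow k.
have kS : 1 / 2 ^+ k.+1 = 1 / 2 ^+ k / 2 :> R.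
  by rewrite exprS; field; rewrite expf_neq0.
have nea := near_half IHn.
have dE : eps / 2 ^+ k = eps * (1 / 2 ^+ k) by rewrite mul1r.
split=> [x|x y].
  split=> //; rewrite (le_trans (ui_norm_triangle _ (psi k x) _ _)) //.
  have := (IHn x).2; have := averaging_near nea IHd x.
  rewrite -/(psi k.+1) kS dE; lra.
apply: le_trans (averaging_defect nea IHd x y) _.
have -> : eps / 2 ^+ k.+1 = eps * (1 / 2 ^+ k / 2) by rewrite -kS mul1r.
rewrite dE expr2; move: (1 / _) k0 k1 => t t0 t1.
have et0 : 0 <= eps * t by rewrite mulr_ge0 // ltW.
have et1 : eps * t <= 16^-1.
  by rewrite -[leRHS]mulr1 ler_pM // ltW.
have := ler_wpM2l et0 et1; lra.
Qed.

Lemma averaging_limit : exists pi : Gamma -> 'M[R[i]]_n,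
  (forall x y, pi (x * y)%g = pi x *m pi y) /\
  forall x, N (pi x - u x) <= 4 * eps.
Proof.
have nea k := near_half (psi_invariant k).1.
have inc x k : N (psi k.+1 x - psi k x) <= 2 * eps / 2 ^+ k.
  by rewrite -mulrA; exact: averaging_near (nea k) (psi_invariant k).2 x.
pose pi x := projT1 (cid (mx_geometric_limit (inc x))).
have piP x : exists D, forall k, N (psi k x - pi x) <= D / 2 ^+ k.
  by rewrite /pi; case: cid.
exists pi; split=> [x y|x]; last first.
  apply/ler_addgt0Pr => e e0; have [D hD] := piP x.
  have [k hk] := exp2_small D e0.
  rewrite (le_trans (ui_norm_triangle _ (psi k x) _ _)) //.
  have := hD k; rewrite ui_norm_distC.
  have := ((psi_invariant k).1 x).2.
  have /andP[k0 _] := half_pow k.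
  have := eps_ge0; move: (1 / _) k0 => t; nra.
apply/eqP; rewrite -subr_eq0; apply/eqP/(@ui_norm_eq0 _ _ N)/le_anti.
rewrite ui_norm_ge0 andbT; apply/ler_addgt0Pr => e e0; rewrite add0r.
have [Dx hx] := piP x; have [Dy hy] := piP y; have [Dxy hxy] := piP (x * y)%g.
(* The k-th iterate differs from [pi] at [x * y], at [x] and at [y], and from a
   multiplicative map, by multiples of [1 / 2 ^+ k]. *)
have [k] :=
  exp2_small (Dxy + eps + (Dx * (N (u y) + 2^-1) + N (pi x) * Dy)) e0.
apply: le_trans.
rewrite (le_trans (ui_norm_triangle _ (psi k (x * y)%g) _ _)) //.
rewrite 2!mulrDl -addrA lerD //; first by rewrite ui_norm_distC.
rewrite (le_trans (ui_norm_triangle _ (psi k x *m psi k y) _ _)) // lerD //.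
  exact: (psi_invariant k).2.
have -> : psi k x *m psi k y - pi x *m pi y =
    (psi k x - pi x) *m psi k y + pi x *m (psi k y - pi y).
  by rewrite mulmxBl mulmxBr addrA subrK.
rewrite (le_trans (ui_normD _ _ _)) // mulrDl lerD //.
  rewrite (le_trans (ui_normM _ _ _)) // mulrAC ler_pM ?ui_norm_ge0 //.
  rewrite -[psi k y](subrK (u y)) addrC (le_trans (ui_normD _ _ _)) // lerD2l.
  exact: (nea k y).2.
by rewrite (le_trans (ui_normM _ _ _)) // -mulrA ler_wpM2l // ui_norm_ge0.
Qed.

End Newton.

(** * Square roots near the identity and unitarization *)

Section SquareRoot.
Context {R : realType} {n : nat} (N : ui_norm R n).
Implicit Types (A S T : 'M[R[i]]_n) (k l : 'I_n -> R).

Definition real_diag k : 'M[R[i]]_n := diag_mx (\row_i (k i)%:C).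

Lemma real_diagM k l :
  real_diag k *m real_diag l = real_diag (fun i => k i * l i).
Proof.
rewrite mulmx_diag; congr diag_mx; apply/rowP => i.
by rewrite !mxE -rmorphM.
Qed.

Lemma real_diag_adj k : (real_diag k)^t* = real_diag k.
Proof.
rewrite tr_diag_mx map_diag_mx; congr diag_mx; apply/rowP => i.
by rewrite !mxE; exact: conjc_real.
Qed.

Lemma real_diagB1 k : real_diag k - 1%:M = real_diag (fun i => k i - 1).
Proof.
rewrite -diag_const_mx -raddfB; congr diag_mx; apply/rowP => i.
by rewrite !mxE rmorphB.
Qed.

(** A real number of modulus at most 1 is the average of the two conjugate
    numbers of modulus 1 having it as real part. *)
Lemma ui_norm_mul_contraction A k :
  (forall i, `|k i| <= 1) -> N (A *m real_diag k) <= N A.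
Proof.
move=> k1; pose w : 'rV[R[i]]_n := \row_i (k i +i* Num.sqrt (1 - k i ^+ 2)).
have sq i : Num.sqrt (1 - k i ^+ 2) ^+ 2 = 1 - k i ^+ 2.
  by rewrite sqr_sqrtr // subr_ge0 -real_normK ?num_real // expr_le1.
have W : diag_mx w \is unitarymx.
  apply/unitarymxP; rewrite tr_diag_mx map_diag_mx mulmx_diag -diag_const_mx.
  congr diag_mx; apply/rowP => i; rewrite !mxE /=.
  apply/eqP; rewrite eq_complex /= -!expr2; have := sq i.
  set s := Num.sqrt _ => hs; apply/andP; split; apply/eqP; last by ring.
  by rewrite mulrN opprK -expr2 hs; ring.
have -> : real_diag k = (2^-1)%:C *: (diag_mx w + (diag_mx w)^t*).
  rewrite tr_diag_mx map_diag_mx -raddfD -linearZ; congr diag_mx.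
  apply/rowP => i; rewrite !mxE /=; apply/eqP; rewrite eq_complex /=.
  by apply/andP; split; apply/eqP; field.
rewrite -scalemxAr ui_normZ normcR ger0_norm ?invr_ge0 // mulmxDr.
have := ui_normD N (A *m diag_mx w) (A *m (diag_mx w)^t*).
by rewrite !ui_norm_mulur ?trmxC_unitary //; lra.
Qed.

Lemma ui_norm_diag_entry k i : `|k i| <= N (real_diag k).
Proof.
rewrite -(ler_pM2l (ui_norm_gt0 N (delta_mx_neq0 _ i i))).
rewrite (le_trans _ (ui_normM _ _ _)) //.
rewrite mulrC -normcR -ui_normZ le_eqVlt; apply/orP; left; apply/eqP.
congr (N _); apply/matrixP => a b; rewrite mul_mx_diag !mxE mulrC.
by case: (b =P i) => [->//|_]; rewrite andbF !mul0r.
Qed.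

(** Diagonalize [S]: its eigenvalues [s] are within [N (S - 1) < 1] of 1,
    hence positive, and [sqrt s - 1 = (s - 1) / (sqrt s + 1)] exhibits
    [T - 1] as the product of [S - 1] and of a contraction. *)
Lemma hermitian_sqrt S : S^t* = S -> N (S - 1%:M) < 1 ->
  exists T, [/\ T^t* = T, T *m T = S & N (T - 1%:M) <= N (S - 1%:M)].
Proof.
move=> Sh S1; set P := spectralmx S.
have hP : P \is unitarymx by exact: spectral_unitarymx.
have hP' : P^t* \is unitarymx by rewrite trmxC_unitary.
have PP : P *m P^t* = 1%:M by exact/unitarymxP.
have PP' : P^t* *m P = 1%:M by exact: unitary_mulV.
have Sherm : S \is hermsymmx by rewrite is_hermitianmxE expr0 scale1r Sh.
pose s i : R := Re (spectral_diag S 0 i).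
have SE : S = P^t* *m real_diag s *m P.
  have /orthomx_spectralP := hermitian_normalmx Sherm.
  rewrite invmx_unitary // => {1}->; congr (_ *m diag_mx _ *m _).
  apply/rowP => i; rewrite !mxE RRe_real //.
  by have /mxOverP := hermitian_spectral_diag_real Sherm; apply.
have conjB1 D : P^t* *m D *m P - 1%:M = P^t* *m (D - 1%:M) *m P.
  by rewrite mulmxBr mulmxBl mulmx1 PP'.
have S1E : N (S - 1%:M) = N (real_diag s - 1%:M).
  by rewrite SE conjB1 ui_norm_unitary.
have s0 i : 0 < s i.
  have := ui_norm_diag_entry (fun i => s i - 1) i.
  by rewrite -real_diagB1 -S1E => /le_lt_trans/(_ S1); rewrite ltr_norml; lra.
pose r i := Num.sqrt (s i).
have r0 i : 0 < r i by rewrite sqrtr_gt0.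
have rr i : r i * r i = s i by rewrite -expr2 sqr_sqrtr // ltW.
exists (P^t* *m real_diag r *m P); split.
- by rewrite !adjM real_diag_adj trmxCK mulmxA.
- rewrite -!mulmxA (mulmxA P) PP mul1mx (mulmxA (real_diag r)) real_diagM.
  rewrite mulmxA [RHS]SE; congr (_ *m real_diag _ *m _).
  by apply/funext => i; exact: rr.
- rewrite conjB1 ui_norm_unitary // S1E !real_diagB1.
  have -> : real_diag (fun i => r i - 1) =
      real_diag (fun i => s i - 1) *m real_diag (fun i => (r i + 1)^-1).
    rewrite real_diagM; congr real_diag; apply/funext => i.
    by rewrite -rr; field; have := r0 i; rewrite gt_eqF // addr_gt0.
  apply: ui_norm_mul_contraction => i.
  have ri := r0 i; rewrite ger0_norm ?invr_ge0 ?invf_le1; lra.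
Qed.

End SquareRoot.

Section Unitarization.
Context {R : realType} {Gamma : groupType}.
Context (m : (Gamma -> R) -> R) (hm : left_invariant_mean m).
Context {n : nat} (N : ui_norm R n).
Hypothesis N_adj : forall A, N (A^t*) = N A.

(** The averaged form [S] is invariant under [pi], so that conjugating [pi] by
    the square root [T] of [S] makes it unitary. As [pi] is close to unitaries,
    [S] is within [3 d] of 1, hence so is [T], and the conjugation moves [pi] by
    at most [2 * 2 * (3 * d) * (1 + d) <= 14 * d]. *)
Lemma unitarize (u pi : Gamma -> 'M[R[i]]_n) d :
  (forall x y, pi (x * y)%g = pi x *m pi y) ->
  near_unitary N u pi d -> d <= 6^-1 ->
  exists rho : Gamma -> 'M[R[i]]_n,
    [/\ forall x y, rho (x * y)%g = rho x *m rho y,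
        forall x, rho x \is unitarymx &
        forall x, N (rho x - u x) <= 15 * d].
Proof.
move=> piM pi_near d6.
have d0 : 0 <= d by apply: le_trans (pi_near 1%g).2; exact: ui_norm_ge0.
(* The argument is [y^-1] because the mean is invariant on the left, whereas
   [pi x] has to act on the right of [pi y]. *)
pose F y := (pi y^-1%g)^t* *m pi y^-1%g.
have F1 y : N (F y - 1%:M) <= 3 * d.
  rewrite /F; have [hv hD] := pi_near y^-1%g.
  move: (u _) hv hD => v hv; set D := _ - _ => hD.
  have -> : pi y^-1%g = v + D by rewrite /D addrC subrK.
  have -> : (v + D)^t* *m (v + D) - 1%:M = D^t* *m v + D^t* *m D + v^t* *m D.
    rewrite adjD mulmxDl !mulmxDr unitary_mulV //.
    by rewrite addrAC [1%:M + _]addrC addrK addrC.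
  rewrite (le_trans (ui_normD _ _ _)) // ui_norm_mulul ?trmxC_unitary //.
  have := ui_normD N (D^t* *m v) (D^t* *m D); rewrite ui_norm_mulur // N_adj.
  have := ui_normM N (D^t*) D; rewrite N_adj.
  have := ui_norm_ge0 N D; move: (N D) hD => t; nra.
have bF : mxbounded N F.
  exists (3 * d + N 1%:M) => y; rewrite -[F y](subrK 1%:M).
  by rewrite (le_trans (ui_normD _ _ _)) // lerD2r.
set S := mxmean m F.
have Sinv x : (pi x)^t* *m S *m pi x = S.
  have bF' : mxbounded N (fun y => (pi x)^t* *m F y).
    exact: (mxboundedM (mxbounded_cst _ _)).
  rewrite -(mxmean_mull hm _ bF) -(mxmean_mulr hm _ bF').
  rewrite -[RHS](mxmean_left_invariant hm x bF); congr mxmean.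
  by apply/funext => y; rewrite /F invgM invgK piM adjM !mulmxA.
have Sh : S^t* = S.
  rewrite -(mxmean_adj hm bF); congr mxmean; apply/funext => y.
  by rewrite /F adjM trmxCK.
have S1 : N (S - 1%:M) <= 3 * d.
  rewrite -[in X in _ - X](mxmean_cst hm 1%:M).
  rewrite -(mxmeanB hm bF (mxbounded_cst _ _)).
  exact: (ui_norm_mxmean hm).
have [|T [Th TT T1]] := hermitian_sqrt Sh (N := N); first by lra.
have T12 : N (T - 1%:M) <= 2^-1 by lra.
have Tunit := near_unitary_unit unitarymx1 T12.
have Tinv_adj : (invmx T)^t* = invmx T by rewrite trmx_inv map_invmx Th.
exists (fun x => T *m pi x *m invmx T); split=> [x y|x|x].
- by rewrite piM !mulmxA mulmxKV.
- apply/unitarymxP/mulmx1C; rewrite !adjM Tinv_adj Th.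
  have -> : invmx T *m ((pi x)^t* *m T) *m (T *m pi x *m invmx T) =
      invmx T *m ((pi x)^t* *m (T *m T) *m pi x) *m invmx T.
    by rewrite !mulmxA.
  by rewrite TT Sinv -TT mulKmx // mulmxV.
have [hu hD] := pi_near x.
rewrite (le_trans (ui_norm_triangle _ (pi x) _ _)) //.
have XE : T *m pi x *m invmx T - pi x =
    ((T - 1%:M) *m pi x - pi x *m (T - 1%:M)) *m invmx T.
  have -> : (T - 1%:M) *m pi x - pi x *m (T - 1%:M) = T *m pi x - pi x *m T.
    by rewrite mulmxBl mulmxBr mul1mx mulmx1 opprB addrA subrK.
  by rewrite mulmxBl mulmxK.
have := near_unitary_inv ((T - 1%:M) *m pi x - pi x *m (T - 1%:M))
  unitarymx1 T12.
rewrite -XE; set X := T - 1%:M.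
have pE : pi x = u x + (pi x - u x) by rewrite addrC subrK.
have XN : N X <= 3 * d by exact: le_trans T1 S1.
have h1 : N (X *m pi x) <= N X + N X * d.
  rewrite pE mulmxDr (le_trans (ui_normD _ _ _)) // ui_norm_mulur // lerD2l.
  by rewrite (le_trans (ui_normM _ _ _)) // ler_wpM2l ?ui_norm_ge0.
have h2 : N (pi x *m X) <= N X + d * N X.
  rewrite pE mulmxDl (le_trans (ui_normD _ _ _)) // ui_norm_mulul // lerD2l.
  by rewrite (le_trans (ui_normM _ _ _)) // ler_wpM2r ?ui_norm_ge0.
have := ui_normB N (X *m pi x) (pi x *m X); have := ui_norm_ge0 N X.
move: (N X) XN h1 h2 => t; nra.
Qed.

End Unitarization.

(** * Stability *)

Theorem corollary3p3p6 (R : realType) (Gamma : groupType)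
    (hGamma : amenable R Gamma) :
  uniformly_stable_linear Gamma (@unitary_family R).
Proof.
(* The averaging needs [eps <= 1 / 16], and unitarizing its limit, which is
   within [4 * eps] of unitaries, needs [4 * eps <= 1 / 6] and moves it to
   within [15 * (4 * eps)]. *)
case: hGamma => m hm; exists 24^-1, 60; split => // eps eps_small [n N] phi.
move=> /ereal_supP phi_eps; set u := fun x => unitary_val (phi x).
have u_unitary x : u x \is unitarymx by exact: unitary_valP.
pose N' := adj_norm N.
have u_defect : defect_le N' u eps.
  move=> x y; rewrite adj_norm_sub_unitary ?mul_unitarymx //.
  by rewrite -lee_fin; apply: phi_eps; exists x => //; exists y.
have [|pi [piM pi_near]] := averaging_limit hm u_unitary u_defect; first by lra.
have near : near_unitary N' u pi (4 * eps) by move=> x; split.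
have [|rho [rhoM rho_unitary rho_near]] :=
  unitarize hm (adj_norm_adj N) piM near; first by lra.
pose psi x : unitary_group N := UnitaryGroup N (rho_unitary x).
have psi_morph : {morph psi : x y / (x / y)%g}.
  move=> x y; apply: (mulIg (psi y)); rewrite divgK.
  by apply: val_inj; rewrite /= -rhoM divgK.
pose Psi := HB.pack_for (UMagmaMorphism.type Gamma (unitary_group N)) psi
  (isGroupMorphism.Build _ _ psi psi_morph).
apply: ge_ereal_inf; exists (sup_dist phi Psi); first by exists Psi.
apply: ge_ereal_sup => _ [x _ <-]; rewrite lee_fin.
apply: le_trans (adj_norm_ge N _) _.
by have := rho_near x; rewrite ui_norm_distC mulrA; lra.
Qed.
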